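(* Let $G$ be a compact real algebraic group. Let $S$ be a free $G$-$\mathcal{AS}$-set and let $A$ be any $G$-$\mathcal{AS}$-set. Then the Cartesian product $A \times S$, equipped with the diagonal action $G \times A \times S \to A \times S$, $(g,x,y) \mapsto (g\cdot x, g \cdot y)$, of $G$, is a free $G$-$\mathcal{AS}$-set.
   Context: A real algebraic group is a real algebraic set $G \subset \mathbb{R}^m$ with a group structure whose multiplication and inverse maps are restrictions of polynomial maps; compact refers to the Euclidean topology. A polynomial representation $\mathbb{R}^n$ of $G$ is a linear action of $G$ on $\mathbb{R}^n$ given by matrices whose entries are polynomial in $g \in G \subset \mathbb{R}^m$. A Nash submanifold of dimension $d$ of $\mathbb{R}^n$ is a semialgebraic subset that, near each of its points, is mapped by a Nash (semialgebraic analytic) diffeomorphism between open semialgebraic subsets of $\mathbb{R}^n$ onto an open piece of $\mathbb{R}^d \times \{0\}$. A Nash manifold is a real analytic manifold with a finite atlas of charts with open semialgebraic images in $\mathbb{R}^n$ and Nash diffeomorphisms as transition maps; a compact affine Nash manifold is a compact Nash manifold that is Nash-diffeomorphic to a Nash submanifold of some $\mathbb{R}^n$. A subset of a Nash manifold is semialgebraic if its images in the charts of the Nash atlas are semialgebraic. Let $M$ be a compact affine Nash manifold. A subset $A\subset M$ is arc-symmetric if for every real analytic arc $\gamma : ]-1;1[ \to M$, $\gamma(]-1;0[) \subset A$ implies $\gamma(]-1;1[) \subset A$. It is an $\mathcal{AS}$-set of $M$ if it is semialgebraic and for every real analytic arc $\gamma : ]-1;1[\to M$ with $\gamma(]-1;0[)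 \subset A$ there is $\epsilon \in ]0;1[$ with $\gamma(]0;\epsilon[) \subset A$. The semialgebraic arc-symmetric subsets are the closed sets of a topology on $M$, and the $\mathcal{AS}$-closure $\overline{S}^{\mathcal{AS}}$ is the closure in this topology. ''An $\mathcal{AS}$-set'' means an $\mathcal{AS}$-set of some compact affine Nash manifold; a product of $\mathcal{AS}$-sets is considered in the product manifold. A map between $\mathcal{AS}$-sets of $M$ and $N$ has $\mathcal{AS}$-graph if its graph is an $\mathcal{AS}$-set of $M\times N$. Let $S$ be an $\mathcal{AS}$-set of $M$ equipped with an action of $G$. A $G$-linearization of $S$ is an equivariant homeomorphism with $\mathcal{AS}$-graph $\Phi : S \to S'$ onto a $G$-stable $\mathcal{AS}$-set $S'$ of a compact Nash submanifold $N$ of a polynomial representation $\mathbb{R}^n$ of $G$; it is free if the action of $G$ on the $\mathcal{AS}$-closure of $S'$ in $N$ is free. $S$ is a $G$-$\mathcal{AS}$-set (resp. a free $G$-$\mathcal{AS}$-set) if it has a $G$-linearization (resp. a free $G$-linearization). *)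

(* Defs.v *)
From HB Require Import structures.
From mathcomp Require Import all_boot all_order all_algebra.
From mathcomp Require Import all_classical all_reals all_analysis.
From mathcomp Require mpoly summability.
Import Order.TTheory GRing.Theory Num.Theory.
Import numFieldNormedType.Exports.

Set Implicit Arguments.
Unset Strict Implicit.
Unset Printing Implicit Defensive.

Local Open Scope classical_set_scope.
Local Open Scope ring_scope.

(* mpoly is not Imported: its notations clash with those of analysis. *)
Notation polynomial n R := (mpoly.mpoly n R).

Definition peval (R : realType) n (p : polynomial n R) (x : 'rV[R]_n) : R :=
  mpoly.meval (fun i => x 0 i) p.

Definition polynomial_on (R : realType) p q (D : set 'rV[R]_p)
    (f : 'rV[R]_p -> 'rV[R]_q) :=
  exists P : 'I_q -> polynomial p R,
    forall x, D x -> forall j, f x 0 j = peval (P j) x.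

Definition algebraic_set (R : realType) n (V : set 'rV[R]_n) :=
  exists B : set (polynomial n R),
    V = [set x | forall p, B p -> peval p x = 0].

(* The Boolean algebra of subsets of R^n generated by the {p > 0}. *)
Inductive semialgebraic (R : realType) n : set 'rV[R]_n -> Prop :=
| semialgebraic_gt0 (p : polynomial n R) :
    semialgebraic [set x | 0 < peval p x]
| semialgebraicC A : semialgebraic A -> semialgebraic (~` A)
| semialgebraicU A B :
    semialgebraic A -> semialgebraic B -> semialgebraic (A `|` B)
| semialgebraicI A B :
    semialgebraic A -> semialgebraic B -> semialgebraic (A `&` B).

(* Near a, each coordinate of f is the unordered sum of a power series in
   x - a; over the reals, unordered convergence is absolute convergence. *)
Definition analytic_at (R : realType) p q (f : 'rV[R]_p -> 'rV[R]_q)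
    (a : 'rV[R]_p) :=
  forall j : 'I_q, exists c : {ffun 'I_p -> nat} -> R,
    \forall x \near (a : 'rV[R]_p),
      summability.partial_sum
        (fun k : {ffun 'I_p -> nat} =>
           c k * \prod_(i < p) ((x : 'rV[R]_p) 0 i - a 0 i) ^+ k i)
        @ summability.totally --> f x 0 j.

Definition nash_on (R : realType) p q (W : set 'rV[R]_p)
    (f : 'rV[R]_p -> 'rV[R]_q) :=
  [/\ open W, semialgebraic W,
      semialgebraic [set row_mx x (f x) | x in W] &
      forall x, W x -> analytic_at f x].

Definition nash_diffeo (R : realType) p q (W : set 'rV[R]_p)
    (W' : set 'rV[R]_q) (f : 'rV[R]_p -> 'rV[R]_q) :=
  [/\ set_bij W W' f, nash_on W f &
      exists2 f' : 'rV[R]_q -> 'rV[R]_p,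
        nash_on W' f' & forall x, W x -> f' (f x) = x].

Definition homeo_on (T U : topologicalType) (A : set T) (B : set U)
    (f : T -> U) :=
  [/\ set_bij A B f, {within A, continuous f} &
      forall W, open W -> exists2 W', open W' & f @` (A `&` W) = B `&` W'].

Record chart (R : realType) (T : Type) (d : nat) :=
  Chart { cdom : set T ; cmap : T -> 'rV[R]_d }.

(* f reads in the charts c and c' as a Nash diffeomorphism; for f = idfun this
   is the condition on transition maps. *)
Definition nash_in_charts (R : realType) (T U : Type) p q
    (c : chart R T p) (c' : chart R U q) (f : T -> U) :=
  let D := cdom c `&` f @^-1` cdom c' in
  exists2 h : 'rV[R]_p -> 'rV[R]_q,
    nash_diffeo (cmap c @` D) ((cmap c' \o f) @` D) h &
    forall x, D x -> h (cmap c x) = cmap c' (f x).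

(* The data, without the axioms, of a manifold: a subset [points] of a
   topological space and a set of charts on it. *)
Record premanifold (R : realType) := Premanifold {
  carrier : topologicalType ;
  points : set carrier ;
  dimension : nat ;
  atlas : set (chart R carrier dimension) }.

Arguments points {R} p.
Arguments atlas {R} p.

Definition nash_manifold (R : realType) (M : premanifold R) :=
  [/\ hausdorff_space (subspace (points M)),
      finite_set (atlas M),
      points M = \bigcup_(c in atlas M) cdom c,
      forall c, atlas M c ->
        [/\ exists2 W, open W & cdom c = points M `&` W,
            open (cmap c @` cdom c),
            semialgebraic (cmap c @` cdom c) &
            homeo_on (cdom c) (cmap c @` cdom c) (cmap c)] &
      forall c c', atlas M c -> atlas M c' -> nash_in_charts c c' idfun].

Definition nash_manifold_diffeo (R : realType) (M N : premanifold R)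
    (f : carrier M -> carrier N) :=
  homeo_on (points M) (points N) f /\
  forall c c', atlas M c -> atlas N c' -> nash_in_charts c c' f.

Definition prod_chart (R : realType) (T U : Type) p q
    (c : chart R T p) (c' : chart R U q) : chart R (T * U) (p + q) :=
  Chart (cdom c `*` cdom c') (fun z => row_mx (cmap c z.1) (cmap c' z.2)).

Definition prod_premanifold (R : realType) (M N : premanifold R) :
    premanifold R :=
  @Premanifold R (carrier M * carrier N)%type (points M `*` points N)
    (dimension M + dimension N)
    [set prod_chart c c' | c in atlas M & c' in atlas N].

(* Charts of V, a subset of R^n: restrictions to V of the first d coordinates
   of Nash diffeomorphisms straightening V onto an open piece of R^d x {0}. *)
Definition submanifold_chart (R : realType) n d (V : set 'rV[R]_n)
    (c : chart R 'rV[R]_n d) :=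
  exists (led : (d <= n)%N) (W W' : set 'rV[R]_n) (psi : 'rV[R]_n -> 'rV[R]_n),
    [/\ nash_diffeo W W' psi,
        psi @` (V `&` W) =
          W' `&` [set y | forall i : 'I_n, (d <= i)%N -> y 0 i = 0] &
        c = Chart (V `&` W) (fun x => colsub (widen_ord led) (psi x))].

Definition nash_submanifold (R : realType) n d (V : set 'rV[R]_n) :=
  semialgebraic V /\
  forall x, V x -> exists2 c : chart R 'rV[R]_n d,
                     submanifold_chart V c & cdom c x.

Definition submanifold_atlas (R : realType) n d (V : set 'rV[R]_n)
    (C : set (chart R 'rV[R]_n d)) :=
  [/\ finite_set C, C `<=` @submanifold_chart R n d V &
      V `<=` \bigcup_(c in C) cdom c].

Definition submanifold (R : realType) n d (V : set 'rV[R]_n)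
    (C : set (chart R 'rV[R]_n d)) : premanifold R :=
  @Premanifold R 'rV[R]_n V d C.

(* V is the image of the compact M, so that it does have a finite atlas made of
   submanifold charts. *)
Definition compact_affine_nash_manifold (R : realType) (M : premanifold R) :=
  [/\ nash_manifold M, compact (points M) &
      exists n d (V : set 'rV[R]_n) (C : set (chart R 'rV[R]_n d))
             (f : carrier M -> 'rV[R]_n),
        [/\ nash_submanifold d V, submanifold_atlas V C &
            @nash_manifold_diffeo R M (submanifold V C) f]].

Definition semialgebraic_in (R : realType) (M : premanifold R)
    (A : set (carrier M)) :=
  A `<=` points M /\
  forall c, atlas M c -> semialgebraic (cmap c @` (A `&` cdom c)).

(* Arcs are total functions, only their values on ]-1, 1[ matter. *)
Definition analytic_arc (R : realType) (M : premanifold R)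
    (gamma : R -> carrier M) :=
  [/\ gamma @` `]-1, 1[ `<=` points M,
      {within (`]-1, 1[ : set R), continuous gamma} &
      forall t, t \in `]-1, 1[ -> forall c, atlas M c -> cdom c (gamma t) ->
        analytic_at (fun s : 'rV[R]_1 => cmap c (gamma (s 0 0))) (const_mx t)].

Definition arc_symmetric (R : realType) (M : premanifold R)
    (A : set (carrier M)) :=
  forall gamma, analytic_arc gamma ->
    gamma @` `]-1, 0[ `<=` A -> gamma @` `]-1, 1[ `<=` A.

Definition AS_set (R : realType) (M : premanifold R) (A : set (carrier M)) :=
  semialgebraic_in A /\
  forall gamma, analytic_arc gamma -> gamma @` `]-1, 0[ `<=` A ->
    exists2 e : R, e \in `]0, 1[ & gamma @` `]0, e[ `<=` A.

Definition AS_closure (R : realType) (M : premanifold R)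
    (A : set (carrier M)) : set (carrier M) :=
  \bigcap_(F in [set F | [/\ semialgebraic_in F, arc_symmetric F & A `<=` F]])
    F.

Record algebraic_group (R : realType) := AlgebraicGroup {
  gdim : nat ;
  gset : set 'rV[R]_gdim ;
  gone : 'rV[R]_gdim ;
  gmul : 'rV[R]_gdim -> 'rV[R]_gdim -> 'rV[R]_gdim ;
  ginv : 'rV[R]_gdim -> 'rV[R]_gdim ;
  gset_algebraic : algebraic_set gset ;
  gset1 : gset gone ;
  gsetM : forall g h, gset g -> gset h -> gset (gmul g h) ;
  gsetV : forall g, gset g -> gset (ginv g) ;
  gmulA : forall g h k, gset g -> gset h -> gset k ->
    gmul g (gmul h k) = gmul (gmul g h) k ;
  gmul1 : forall g, gset g -> gmul gone g = g /\ gmul g gone = g ;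
  gmulV : forall g, gset g -> gmul (ginv g) g = gone /\ gmul g (ginv g) = gone ;
  gmul_polynomial :
    polynomial_on [set z | gset (lsubmx z) /\ gset (rsubmx z)]
      (fun z : 'rV[R]_(gdim + gdim) => gmul (lsubmx z) (rsubmx z)) ;
  ginv_polynomial : polynomial_on gset ginv }.

Arguments gset {R} a.
Arguments gone {R} a.
Arguments gmul {R} a.
Arguments ginv {R} a.

Definition gelt (R : realType) (G : algebraic_group R) : Type :=
  'rV[R]_(gdim G).

Definition is_action (R : realType) (G : algebraic_group R) (T : Type)
    (A : set T) (act : gelt G -> T -> T) :=
  [/\ forall g x, gset G g -> A x -> A (act g x),
      forall x, A x -> act (gone G) x = x &
      forall g h x, gset G g -> gset G h -> A x ->
        act (gmul G g h) x = act g (act h x)].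

Definition polynomial_representation (R : realType) (G : algebraic_group R) n
    (rho : gelt G -> 'M[R]_n) :=
  [/\ rho (gone G) = 1%:M,
      forall g h, gset G g -> gset G h ->
        rho (gmul G g h) = rho g *m rho h &
      exists P : 'I_n -> 'I_n -> polynomial (gdim G) R,
        forall g, gset G g -> forall i j, rho g i j = peval (P i j) g].

(* R^n consists of row vectors: transposing makes this a left action. *)
Definition rep_act (R : realType) (G : algebraic_group R) n
    (rho : gelt G -> 'M[R]_n) (g : gelt G) (x : 'rV[R]_n) : 'rV[R]_n :=
  x *m (rho g)^T.

Record linearization (R : realType) (G : algebraic_group R)
    (M : premanifold R) (S : set (carrier M)) (act : gelt G -> carrier M -> carrier M)
  := Linearization {
  lin_n : nat ;
  lin_rho : gelt G -> 'M[R]_lin_n ;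
  lin_d : nat ;
  lin_N : set 'rV[R]_lin_n ;
  lin_atlas : set (chart R 'rV[R]_lin_n lin_d) ;
  lin_S : set 'rV[R]_lin_n ;
  lin_map : carrier M -> 'rV[R]_lin_n ;
  lin_rho_polynomial : polynomial_representation lin_rho ;
  lin_N_nash : nash_submanifold lin_d lin_N ;
  lin_N_compact : compact lin_N ;
  lin_atlasP : submanifold_atlas lin_N lin_atlas ;
  lin_S_AS : @AS_set R (submanifold lin_N lin_atlas) lin_S ;
  lin_S_stable : forall g x, gset G g -> lin_S x -> lin_S (rep_act lin_rho g x) ;
  lin_homeo : homeo_on S lin_S lin_map ;
  lin_equivariant : forall g x, gset G g -> S x ->
    lin_map (act g x) = rep_act lin_rho g (lin_map x) ;
  lin_graph : @AS_set R (prod_premanifold M (submanifold lin_N lin_atlas))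
    [set (x, lin_map x) | x in S] }.

Arguments lin_rho {R G M S act} l.
Arguments lin_N {R G M S act} l.
Arguments lin_atlas {R G M S act} l.
Arguments lin_S {R G M S act} l.
Arguments lin_map {R G M S act} l.

Definition free_linearization (R : realType) (G : algebraic_group R)
    (M : premanifold R) (S : set (carrier M)) (act : gelt G -> carrier M -> carrier M)
    (L : linearization S act) :=
  forall g x, gset G g ->
    @AS_closure R (submanifold (lin_N L) (lin_atlas L)) (lin_S L) x ->
    rep_act (lin_rho L) g x = x -> g = gone G.

Definition G_AS_set (R : realType) (G : algebraic_group R)
    (M : premanifold R) (S : set (carrier M))
    (act : gelt G -> carrier M -> carrier M) :=
  [/\ compact_affine_nash_manifold M, AS_set S, is_action S act &
      inhabited (linearization S act)].

Definition free_G_AS_set (R : realType) (G : algebraic_group R)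
    (M : premanifold R) (S : set (carrier M))
    (act : gelt G -> carrier M -> carrier M) :=
  [/\ compact_affine_nash_manifold M, AS_set S, is_action S act &
      exists L : linearization S act, free_linearization L].

Definition diagonal_action (R : realType) (G : algebraic_group R) (T U : Type)
    (actT : gelt G -> T -> T) (actU : gelt G -> U -> U) :
    gelt G -> T * U -> T * U :=
  fun g z => (actT g z.1, actU g z.2).

(* Main.v *)
(* The product of two linearizations Phi : A -> A' in V and Psi : S -> S' in V'
   is a linearization of A x S in V x V', inside the direct sum of the two
   representations: being an AS-set is checked on the two components of an arc
   separately. If F is a semialgebraic arc-symmetric subset of V' containing
   S', then V x F is one of V x V' containing A' x S'; hence the second
   projection sends the AS-closure of A' x S' into that of S', on which G acts
   freely. *)
Require Import Defs.
From HB Require Import structures.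
From mathcomp Require Import all_boot all_order all_algebra finmap.
From mathcomp Require Import all_classical all_reals all_analysis.
From mathcomp Require mpoly summability.
From mathcomp Require Import zify.
Import Order.TTheory GRing.Theory Num.Theory.
Import numFieldNormedType.Exports.

Set Implicit Arguments.
Unset Strict Implicit.
Unset Printing Implicit Defensive.

Local Open Scope classical_set_scope.
Local Open Scope ring_scope.

(** A point of V x V' is a row vector of length n + n', so products inside R^n x R^n' are sets
    [box A B] of concatenated rows, and the main obstacle is the order of coordinates. It intervenes
    three times. The graph of a product of Nash maps is the product of their graphs only after the
    two middle blocks are exchanged. A submanifold chart reads the first d coordinates, so a product
    of straightenings must be followed by a permutation. The graph of Phi x Psi lies in (M x N) x (V
    x V'), whereas the given graphs lie in M x V and N x V'. For this last reason AS-sets are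
    studied over an abstract [is_product], whose charts are products up to reordering.
    Semialgebraicity is transported along preimages under polynomial maps, so images are first
    rewritten as combinations of such preimages. In particular V x F is semialgebraic once the
    submanifold V is so in its own charts, which is read off from a straightening of V. *)

(** * Semialgebraic sets under polynomial preimages *)

Section Semialgebraic.
Variable R : realType.

(** Substituting the polynomials of f into Q turns a generator into a generator, and preimages
    commute with the Boolean operations. *)
Lemma semialgebraic_preimage p q (f : 'rV[R]_p -> 'rV[R]_q) (A : set 'rV[R]_q) :
  polynomial_on setT f -> semialgebraic A -> semialgebraic (f @^-1` A).
Proof.
move=> [P fP]; elim=> [Q|B _ IH|B C _ IHB _ IHC|B C _ IHB _ IHC].
- suff -> : f @^-1` [set y | 0 < peval Q y] =
    [set x | 0 < peval (mpoly.comp_mpoly (mktuple P) Q) x].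
    exact: semialgebraic_gt0.
  apply/seteqP; split => x /=; rewrite /peval mpoly.comp_mpoly_meval;
    under [mpoly.meval (fun _ => mpoly.meval _ _) _]mpoly.meval_eq => j
      do rewrite tnth_mktuple -/(peval _ x) -fP//; by [].
- exact: semialgebraicC.
- exact: semialgebraicU.
- exact: semialgebraicI.
Qed.

Lemma polynomial_on_colsub p q (s : 'I_p -> 'I_q) (D : set 'rV[R]_q) :
  polynomial_on D (fun x => colsub s x).
Proof.
exists (fun j => mpoly.mpolyX R (mpoly.mnm1 (s j))) => x _ j.
by rewrite /peval mpoly.mevalXU mxE.
Qed.

Lemma semialgebraic_colsub p q (s : 'I_p -> 'I_q) (A : set 'rV[R]_p) :
  semialgebraic A -> semialgebraic [set x | A (colsub s x)].
Proof. by apply: semialgebraic_preimage; exact: polynomial_on_colsub. Qed.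

End Semialgebraic.

(** * Products of subsets of R^p and R^q inside R^(p + q) *)

Section Box.
Variable R : realType.

Definition box p q (A : set 'rV[R]_p) (B : set 'rV[R]_q) : set 'rV[R]_(p + q) :=
  [set z | A (lsubmx z) /\ B (rsubmx z)].

Lemma boxE p q (A : set 'rV[R]_p) (B : set 'rV[R]_q) :
  box A B = @lsubmx R 1 p q @^-1` A `&` @rsubmx R 1 p q @^-1` B.
Proof. by []. Qed.

Lemma box_row_mx p q (A : set 'rV[R]_p) (B : set 'rV[R]_q) x y :
  box A B (row_mx x y) = (A x /\ B y).
Proof. by rewrite /box /= row_mxKl row_mxKr. Qed.

Lemma semialgebraic_box p q (A : set 'rV[R]_p) (B : set 'rV[R]_q) :
  semialgebraic A -> semialgebraic B -> semialgebraic (box A B).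
Proof.
rewrite boxE lsubmxEsub rsubmxEsub => sA sB.
by apply: semialgebraicI; exact: semialgebraic_colsub.
Qed.

Lemma cvg_rV (T : Type) (F : set_system T) n (f : T -> 'rV[R]_n)
    (a : 'rV[R]_n) : Filter F ->
  (forall j, (fun x => f x 0 j) @ F --> a 0 j) -> f @ F --> a.
Proof.
move=> FF fa W [P Pa PW].
have : \forall x \near F, forall j, P 0 j (f x 0 j).
  by apply: filter_forall => j; exact: (fa j _ (Pa 0 j)).
by apply: filterS => x Px; apply: PW => i j; rewrite ord1.
Qed.

Lemma cvg_row_mx (T : Type) (F : set_system T) p q (f : T -> 'rV[R]_p)
    (g : T -> 'rV[R]_q) (a : 'rV[R]_p) (b : 'rV[R]_q) : Filter F ->
  f @ F --> a -> g @ F --> b -> (fun x => row_mx (f x) (g x)) @ F --> row_mx a b.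
Proof.
move=> FF fa gb; apply: cvg_rV => j.
rewrite -(fintype.splitK j); case: (fintype.split j) => i /=.
- rewrite row_mxEl; under eq_fun do rewrite row_mxEl.
  exact: (cvg_comp _ _ fa (@coord_continuous _ _ _ 0 i a)).
- rewrite row_mxEr; under eq_fun do rewrite row_mxEr.
  exact: (cvg_comp _ _ gb (@coord_continuous _ _ _ 0 i b)).
Qed.

Lemma continuous_colsub p q (s : 'I_p -> 'I_q) :
  continuous (fun x : 'rV[R]_q => colsub s x).
Proof.
move=> x; apply: (@cvg_rV _ (nbhs x)) => j; rewrite mxE; under eq_fun do rewrite mxE.
exact: coord_continuous.
Qed.

Lemma continuous_lsubmx p q : continuous (@lsubmx R 1 p q).
Proof. by rewrite lsubmxEsub; exact: continuous_colsub. Qed.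

Lemma continuous_rsubmx p q : continuous (@rsubmx R 1 p q).
Proof. by rewrite rsubmxEsub; exact: continuous_colsub. Qed.

Lemma open_box p q (A : set 'rV[R]_p) (B : set 'rV[R]_q) :
  open A -> open B -> open (box A B).
Proof.
move=> oA oB; rewrite boxE; apply: openI.
  by apply: open_comp oA => x _; exact: continuous_lsubmx.
by apply: open_comp oB => x _; exact: continuous_rsubmx.
Qed.

Lemma compact_box p q (A : set 'rV[R]_p) (B : set 'rV[R]_q) :
  compact A -> compact B -> compact (box A B).
Proof.
move=> cA cB.
have -> : box A B = (fun z => row_mx z.1 z.2) @` (A `*` B).
  apply/seteqP; split=> [z [zA zB]|_ [[x y] [/= Ax By] <-]].
    by exists (lsubmx z, rsubmx z) => //=; rewrite hsubmxK.
  by rewrite box_row_mx.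
apply: continuous_compact; last exact: compact_setX.
apply: continuous_subspaceT => z.
by apply: cvg_row_mx; [exact: cvg_fst|exact: cvg_snd].
Qed.

End Box.

(** * Power series and analyticity under selection of coordinates *)

Section Summation.
Variable R : realType.

(** The terms outside the range of h vanish, so if a finite set A controls the sums over I, then its
    image under h controls those over J. It serves to pass from multi-indices in p variables to
    multi-indices in q variables. *)
Lemma cvg_partial_sum_inj (I J : choiceType) (h : I -> J) (g : J -> I)
    (u : J -> R) (l : R) : cancel h g ->
  (forall j, h (g j) != j -> u j = 0) ->
  summability.partial_sum (u \o h) @ summability.totally --> l ->
  summability.partial_sum u @ summability.totally --> l.
Proof.
move=> hK u0 ul W /ul [A _ AW].
exists (h @` A)%fset => // B /= AB.
(* C is the part of B inside the range of h; the rest of B contributes 0. *)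
pose C := [fset j in B | h (g j) == j]%fset.
suff <- : summability.partial_sum (u \o h) (g @` C)%fset =
          summability.partial_sum u B.
  apply: AW => /=; apply/fsubsetP => i iA.
  apply/imfsetP; exists (h i) => /=; last by rewrite hK.
  rewrite !inE /= hK eqxx andbT.
  by move/fsubsetP : AB; apply; apply/imfsetP; exists i.
rewrite /summability.partial_sum.
rewrite -(big_seq_fsetE _ _ xpredT u).
rewrite -(big_seq_fsetE _ _ xpredT (u \o h)).
rewrite big_imfset /=; last first.
  move=> i j; rewrite !inE /= => /andP[_ /eqP hi] /andP[_ /eqP hj] ij.
  by rewrite -hi -hj ij.
rewrite [RHS](bigID (fun j => h (g j) == j)) /= [X in _ + X]big1 ?addr0 //.
rewrite [RHS]big_fset_condE /=.
rewrite big_seq [RHS]big_seq; apply: eq_bigr => j.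
by rewrite !inE /= => /andP[_ /eqP ->].
Qed.

(* The power series of [f], with exponents extended by 0 outside the range of [s]. *)
Lemma analytic_at_colsub p q r (s : 'I_p -> 'I_q) (f : 'rV[R]_p -> 'rV[R]_r)
    (a : 'rV[R]_q) : injective s ->
  analytic_at f (colsub s a) -> analytic_at (fun x => f (colsub s x)) a.
Proof.
move=> sI fa j; have [c cf] := fa j.
pose h (k : {ffun 'I_p -> nat}) : {ffun 'I_q -> nat} :=
  [ffun j => (\sum_(i | s i == j) k i)%N].
pose g (k : {ffun 'I_q -> nat}) : {ffun 'I_p -> nat} := [ffun i => k (s i)].
have hK : cancel h g.
  move=> k; apply/ffunP => i; rewrite !ffunE (big_pred1 i)// => i'.
  by rewrite (inj_eq sI).
exists (fun k => if h (g k) == k then c (g k) else 0).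
have := @continuous_colsub R _ _ s a _ cf; rewrite nbhs_simpl => {cf}cf.
apply: (@filterS _ (nbhs a) _ _ _ _ cf) => x /= cx.
apply: (cvg_partial_sum_inj hK) => [k /negPf ->|]; first by rewrite mul0r.
move: cx; set v := (X in summability.partial_sum X); rewrite (_ : _ \o h = v) //.
apply/funext => k; rewrite /v /= hK eqxx; congr (_ * _).
rewrite (partition_big s xpredT)//=; apply: eq_bigr => i _.
rewrite ffunE expr_sum; apply: eq_bigr => i' /eqP <-.
by rewrite !mxE.
Qed.

Lemma analytic_at_coords p q r (f : 'rV[R]_p -> 'rV[R]_q)
    (g : 'rV[R]_p -> 'rV[R]_r) (a : 'rV[R]_p) :
  (forall j, exists i, forall x, g x 0 j = f x 0 i) ->
  analytic_at f a -> analytic_at g a.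
Proof.
move=> fg fa j; have [i gf] := fg j; have [c cf] := fa i; exists c.
by apply: filterS cf => x; rewrite -gf.
Qed.

Lemma analytic_at_row_mx p q r (f : 'rV[R]_p -> 'rV[R]_q)
    (g : 'rV[R]_p -> 'rV[R]_r) (a : 'rV[R]_p) :
  analytic_at f a -> analytic_at g a -> analytic_at (fun x => row_mx (f x) (g x)) a.
Proof.
move=> fa ga j; rewrite -(fintype.splitK j); case: (fintype.split j) => i /=.
- have [c cf] := fa i; exists c.
  by apply: filterS cf => x; rewrite row_mxEl.
- have [c cg] := ga i; exists c.
  by apply: filterS cg => x; rewrite row_mxEr.
Qed.

End Summation.

(** * Permutations of coordinate blocks *)

Section Indices.

(** The exchange of the two middle blocks, written on indices. Since [colsub] is contravariant in
    the index map, the source carries the new order of the blocks and the target the old one. *)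
Definition interchange p q r s (i : 'I_((p + r) + (q + s))) :
    'I_((p + q) + (r + s)) :=
  match fintype.split i with
  | inl j => match fintype.split j with
             | inl k => lshift _ (lshift _ k) | inr k => rshift _ (lshift _ k) end
  | inr j => match fintype.split j with
             | inl k => lshift _ (rshift _ k) | inr k => rshift _ (rshift _ k) end
  end.

Lemma interchangeK p q r s :
  cancel (@interchange p q r s) (@interchange p r q s).
Proof.
move=> i; rewrite -(fintype.splitK i); case: (fintype.split i) => j;
  rewrite -(fintype.splitK j); case: (fintype.split j) => k;
  by rewrite /interchange /= !(unsplitK (inl _), unsplitK (inr _)).
Qed.

Lemma colsub_interchange (T : Type) p q r s (a : 'rV[T]_p) (b : 'rV[T]_q)
    (c : 'rV[T]_r) (d : 'rV[T]_s) :
  colsub (@interchange p q r s) (row_mx (row_mx a b) (row_mx c d)) =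
  row_mx (row_mx a c) (row_mx b d).
Proof.
apply/rowP => i; rewrite -(fintype.splitK i); case: (fintype.split i) => j;
  rewrite -(fintype.splitK j); case: (fintype.split j) => k;
  by rewrite mxE /interchange /= !(unsplitK (inl _), unsplitK (inr _)) /=
             ?(row_mxEl, row_mxEr).
Qed.

Lemma colsubK (T : Type) p q (s : 'I_p -> 'I_q) (t : 'I_q -> 'I_p) :
  cancel t s -> cancel (fun x : 'rV[T]_q => colsub s x) (colsub t).
Proof. by move=> tK x; apply/rowP => i; rewrite !mxE tK. Qed.

Lemma colsub_id (T : Type) p (x : 'rV[T]_p) : colsub id x = x.
Proof. by apply/rowP => i; rewrite mxE. Qed.

End Indices.

(** * Products and coordinate permutations of Nash maps *)

Section BoxNash.
Variable R : realType.

Lemma polynomial_on_row_mx p q r (D : set 'rV[R]_p) (f : 'rV[R]_p -> 'rV[R]_q)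
    (g : 'rV[R]_p -> 'rV[R]_r) :
  polynomial_on D f -> polynomial_on D g ->
  polynomial_on D (fun x => row_mx (f x) (g x)).
Proof.
move=> [P fP] [Q gQ]; exists (fun j => match fintype.split j with
  inl i => P i | inr i => Q i end) => x Dx j.
rewrite -(fintype.splitK j); case: (fintype.split j) => i; rewrite unsplitK /=.
  by rewrite row_mxEl fP.
by rewrite row_mxEr gQ.
Qed.

(** For graphs: s reindexes the source coordinates and t the target coordinates. *)
Lemma semialgebraic_colsub2 p q p' q' (s : 'I_p -> 'I_p') (t : 'I_q -> 'I_q')
    (A : set 'rV[R]_(p + q)) : semialgebraic A ->
  semialgebraic [set z : 'rV[R]_(p' + q') |
    A (row_mx (colsub s (lsubmx z)) (colsub t (rsubmx z)))].
Proof.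
apply: semialgebraic_preimage; apply: polynomial_on_row_mx.
  rewrite lsubmxEsub (_ : (fun _ => _) = colsub (lshift q' \o s)).
    exact: polynomial_on_colsub.
  by apply/funext => x; apply/rowP => j; rewrite !mxE.
rewrite rsubmxEsub (_ : (fun _ => _) = colsub (@rshift p' q' \o t)).
  exact: polynomial_on_colsub.
by apply/funext => x; apply/rowP => j; rewrite !mxE.
Qed.

Definition box_map p p' q q' (f : 'rV[R]_p -> 'rV[R]_q)
    (g : 'rV[R]_p' -> 'rV[R]_q') (x : 'rV[R]_(p + p')) : 'rV[R]_(q + q') :=
  row_mx (f (lsubmx x)) (g (rsubmx x)).

Lemma box_map_row_mx p p' q q' (f : 'rV[R]_p -> 'rV[R]_q)
    (g : 'rV[R]_p' -> 'rV[R]_q') x y :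
  box_map f g (row_mx x y) = row_mx (f x) (g y).
Proof. by rewrite /box_map row_mxKl row_mxKr. Qed.

Lemma image_box_map p p' q q' (f : 'rV[R]_p -> 'rV[R]_q)
    (g : 'rV[R]_p' -> 'rV[R]_q') A B :
  box_map f g @` box A B = box (f @` A) (g @` B).
Proof.
apply/seteqP; split=> [_ [x [Ax Bx] <-]|y [[a Aa fa] [b Bb gb]]].
  by rewrite box_row_mx; split; [exists (lsubmx x)|exists (rsubmx x)].
exists (row_mx a b); first by rewrite box_row_mx.
by rewrite box_map_row_mx fa gb hsubmxK.
Qed.

Lemma set_bij_box p p' q q' (f : 'rV[R]_p -> 'rV[R]_q)
    (g : 'rV[R]_p' -> 'rV[R]_q') A A' B B' :
  set_bij A A' f -> set_bij B B' g -> set_bij (box A B) (box A' B') (box_map f g).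
Proof.
move=> [fA fI fS] [gB gI gS]; split.
- by move=> x [Ax Bx] /=; rewrite box_row_mx; split; [exact: fA|exact: gB].
- move=> x y; rewrite !inE => -[Ax Bx] [Ay By] /eq_row_mx[fxy gxy].
  rewrite -(hsubmxK x) -(hsubmxK y); congr row_mx.
    by apply: fI => //; rewrite inE.
  by apply: gI => //; rewrite inE.
- by rewrite /set_surj image_box_map => y [/fS Ay /gS By].
Qed.

Lemma nash_on_box p p' q q' (f : 'rV[R]_p -> 'rV[R]_q)
    (g : 'rV[R]_p' -> 'rV[R]_q') A B :
  nash_on A f -> nash_on B g -> nash_on (box A B) (box_map f g).
Proof.
move=> [oA sA sf af] [oB sB sg ag]; split.
- exact: open_box.
- exact: semialgebraic_box.
(* The rows of the graph of [box_map f g] are (x, x', f x, g x'), those of the product of the graphs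
   are (x, f x, x', g x'). *)
- rewrite (_ : [set _ | _ in _] = [set z | box [set row_mx x (f x) | x in A]
      [set row_mx x (g x) | x in B] (colsub (@interchange p p' q q') z)]).
    by apply: semialgebraic_colsub; exact: semialgebraic_box.
  apply/seteqP; split=> [_ [x [Ax Bx] <-] /=|z /= [[a Aa az] [b Bb bz]]].
    rewrite -{1}(hsubmxK x) colsub_interchange box_row_mx.
    by split; [exists (lsubmx x)|exists (rsubmx x)].
  exists (row_mx a b); first by rewrite box_row_mx.
  rewrite box_map_row_mx -[RHS](colsubK (@interchangeK p q p' q')).
  by rewrite -[colsub _ z]hsubmxK -az -bz colsub_interchange.
- move=> x [Ax Bx]; apply: analytic_at_row_mx.
    rewrite lsubmxEsub; apply: analytic_at_colsub; first exact: lshift_inj.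
    by rewrite -lsubmxEsub; exact: af.
  rewrite rsubmxEsub; apply: analytic_at_colsub; first exact: rshift_inj.
  by rewrite -rsubmxEsub; exact: ag.
Qed.

Lemma nash_diffeo_box p p' q q' (f : 'rV[R]_p -> 'rV[R]_q)
    (g : 'rV[R]_p' -> 'rV[R]_q') A A' B B' :
  nash_diffeo A A' f -> nash_diffeo B B' g ->
  nash_diffeo (box A B) (box A' B') (box_map f g).
Proof.
move=> [fA nf [f' nf' fK]] [gB ng [g' ng' gK]]; split.
- exact: set_bij_box.
- exact: nash_on_box.
- exists (box_map f' g'); first exact: nash_on_box.
  by move=> x [Ax Bx]; rewrite box_map_row_mx fK// gK// hsubmxK.
Qed.

(** Reordering coordinates is linear with inverse of the same kind, hence harmless for graphs and
    power series. It brings to the front the coordinates that a submanifold chart keeps. *)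
Lemma nash_diffeo_perm p q (s t : 'I_q -> 'I_q) (f : 'rV[R]_p -> 'rV[R]_q) A B :
  cancel s t -> cancel t s -> nash_diffeo A B f ->
  nash_diffeo A [set y | B (colsub t y)] (fun x => colsub s (f x)).
Proof.
move=> sK tK [[fA fI fS] [oA sA gf af] [f' [oB sB gf' af'] fK]]; split.
- split=> [x Ax /=|x y xA yA|y /fS[x Ax fx]].
  + by rewrite colsubK//; exact: fA.
  + by move/(can_inj (colsubK tK)); exact: fI.
  + by exists x; rewrite // fx colsubK.
- split=> //.
  + rewrite (_ : [set _ | _ in _] = [set z | [set row_mx x (f x) | x in A]
      (row_mx (colsub id (lsubmx z)) (colsub t (rsubmx z)))]).
      exact: semialgebraic_colsub2.
    apply/seteqP; split=> [_ [x Ax <-]|z [x Ax]] /=.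
      by rewrite row_mxKl row_mxKr colsub_id colsubK//; exists x.
    rewrite colsub_id => /eq_row_mx[xz fz]; exists x => //.
    by rewrite fz colsubK// xz hsubmxK.
  + move=> x /af; apply: analytic_at_coords => j; exists (s j) => y.
    by rewrite mxE.
- exists (fun y => f' (colsub t y)); last by move=> x Ax; rewrite colsubK// fK.
  split.
  + by apply: open_comp oB => y _; exact: continuous_colsub.
  + exact: semialgebraic_colsub.
  + rewrite (_ : [set _ | _ in _] = [set z | [set row_mx x (f' x) | x in B]
      (row_mx (colsub t (lsubmx z)) (colsub id (rsubmx z)))]).
      exact: semialgebraic_colsub2.
    apply/seteqP; split=> [_ [y By <-]|z [y By]] /=.
      by rewrite row_mxKl row_mxKr colsub_id; exists (colsub t y).
    rewrite colsub_id => /eq_row_mx[yz fz]; exists (lsubmx z) => /=.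
      by rewrite -yz.
    by rewrite -yz fz hsubmxK.
  + by move=> y By; apply: analytic_at_colsub; [exact: can_inj tK|exact: af'].
Qed.

End BoxNash.

(** * Products of homeomorphisms between subsets *)

Section Homeo.

(** A pointwise form of openness onto the image: in a product it suffices to treat neighbourhoods
    that are products, whereas an arbitrary open set is not one. *)
Lemma open_mapP (T U : topologicalType) (A : set T) (B : set U) (f : T -> U) :
  set_fun A B f ->
  (forall W, open W -> exists2 W', open W' & f @` (A `&` W) = B `&` W') <->
  (forall x W, A x -> nbhs x W ->
     exists2 W', nbhs (f x) W' & B `&` W' `<=` f @` (A `&` W)).
Proof.
move=> fAB; split=> [fo x W Ax|fo W oW].
  rewrite nbhsE => -[V [oV Vx] VW]; have [V' oV' fV] := fo V oV.
  exists V'; last by rewrite -fV; apply: image_subset; exact: setIS.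
  apply: open_nbhs_nbhs; split=> //.
  suff [] : (B `&` V') (f x) by [].
  by rewrite -fV; exists x.
(* The largest open set whose trace on B lies in the image; the local condition shows that this
   trace exhausts the image. *)
exists (\bigcup_(V in [set V | open V /\ B `&` V `<=` f @` (A `&` W)]) V).
  by apply: bigcup_open => V [].
apply/seteqP; split=> [_ [x [Ax Wx] <-]|y [By [V [oV VW] Vy]]]; last exact: VW.
split; first exact: fAB.
have [V] := fo x W Ax (open_nbhs_nbhs (conj oW Wx)).
rewrite nbhsE => -[V' [oV' V'x] V'V VW]; exists V' => //; split=> //.
by apply: subset_trans VW; exact: setIS.
Qed.

Lemma cvg_within_fst (T U : topologicalType) (A : set T) (B : set U) (x : T) (y : U) :
  fst @ within (A `*` B) (nbhs (x, y)) --> within A (nbhs x).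
Proof.
move=> P xP; exists ([set a | A a -> P a], setT) => /=.
  by split=> //; exact: filterT.
by move=> -[a b] /= [aP _] [Aa _]; exact: aP.
Qed.

Lemma cvg_within_snd (T U : topologicalType) (A : set T) (B : set U) (x : T) (y : U) :
  snd @ within (A `*` B) (nbhs (x, y)) --> within B (nbhs y).
Proof.
move=> P yP; exists (setT, [set b | B b -> P b]) => /=.
  by split=> //; exact: filterT.
by move=> -[a b] /= [_ bP] [_ Bb]; exact: bP.
Qed.

Lemma homeo_on_row_mx (R : realType) (T U : topologicalType) p q
    (A : set T) (A' : set U) (B : set 'rV[R]_p) (B' : set 'rV[R]_q) f f' :
  homeo_on A B f -> homeo_on A' B' f' ->
  homeo_on (A `*` A') (box B B') (fun z => row_mx (f z.1) (f' z.2)).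
Proof.
move=> [[fA fI fS] fc fo] [[fA' fI' fS'] fc' fo'].
have bij : set_bij (A `*` A') (box B B') (fun z => row_mx (f z.1) (f' z.2)).
  split=> [[x y] [Ax A'y] /=|[x y] [x' y']|z [/fS[x Ax xz] /fS'[y Ay yz]]].
  - by rewrite box_row_mx; split; [exact: fA|exact: fA'].
  - rewrite !inE /= => -[Ax Ay] [Ax' Ay'] /eq_row_mx[xx yy].
    by congr pair; [apply: fI|apply: fI']; rewrite ?inE.
  - by exists (x, y); rewrite //= xz yz hsubmxK.
split=> //.
- apply/subspace_continuousP => -[x y] [/= Ax Ay].
  move/subspace_continuousP : fc => /(_ x Ax) fx.
  move/subspace_continuousP : fc' => /(_ y Ay) fy.
  apply: cvg_row_mx.
    exact: cvg_comp (@cvg_within_fst _ _ A A' x y) fx.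
  exact: cvg_comp (@cvg_within_snd _ _ A A' x y) fy.
case: (bij) => bijf _ _; apply/(open_mapP bijf) => -[x y] W [/= Ax Ay].
move=> [[V V'] [/= Vx V'y] VW].
have [X Xx XV] := (open_mapP fA).1 fo x V Ax Vx.
have [Y Yy YV] := (open_mapP fA').1 fo' y V' Ay V'y.
exists (box X Y).
  rewrite boxE; apply: filterI.
    apply: continuous_lsubmx; by rewrite row_mxKl.
  by apply: continuous_rsubmx; rewrite row_mxKr.
move=> z [[Bz B'z] [Xz Yz]].
have [a [Aa Va] az] := XV _ (conj Bz Xz).
have [b [Ab Vb] bz] := YV _ (conj B'z Yz).
by exists (a, b); [split=> //; exact: VW|rewrite /= az bz hsubmxK].
Qed.

End Homeo.

(** * Products of Nash manifolds and of Nash submanifolds *)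

Section ProductCharts.
Variable R : realType.

Lemma image_row_mx (T U : Type) p q (f : T -> 'rV[R]_p) (g : U -> 'rV[R]_q)
    (A : set T) (B : set U) :
  (fun z => row_mx (f z.1) (g z.2)) @` (A `*` B) = box (f @` A) (g @` B).
Proof.
apply/seteqP; split=> [_ [[x y] [Ax By] <-]|z [[a Aa fa] [b Bb gb]]] /=.
  by rewrite box_row_mx; split; [exists x|exists y].
by exists (a, b); rewrite //= fa gb hsubmxK.
Qed.

(** The target chart k and the map h are left general to cover two cases: transition maps, where k
    is a [prod_chart] and h the identity, and maps into R^(n + n'), where k reads concatenated
    rows. *)
Lemma nash_in_charts_prod (T T' U U' V : Type) p p' q q'
    (c : chart R T p) (c' : chart R T' p') (e : chart R U q) (e' : chart R U' q')
    (k : chart R V (q + q')) (f : T -> U) (f' : T' -> U') (h : T * T' -> V) :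
  h @^-1` cdom k = f @^-1` cdom e `*` f' @^-1` cdom e' ->
  (forall z, cmap k (h z) = row_mx (cmap e (f z.1)) (cmap e' (f' z.2))) ->
  nash_in_charts c e f -> nash_in_charts c' e' f' ->
  nash_in_charts (prod_chart c c') k h.
Proof.
move=> hdom hmap [g ng gE] [g' ng' gE']; exists (box_map g g').
  rewrite hdom [_ `&` _](_ : _ = (cdom c `&` f @^-1` cdom e) `*`
    (cdom c' `&` f' @^-1` cdom e')); last by rewrite -setXI.
  rewrite [cmap k \o h](_ : _ = (fun z => row_mx ((cmap e \o f) z.1)
    ((cmap e' \o f') z.2))); last exact/funext.
  by rewrite !image_row_mx; exact: nash_diffeo_box.
move=> z [[cz cz']]; rewrite hdom => -[ez ez'].
by rewrite box_map_row_mx gE// gE'.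
Qed.

Lemma subspace_inE (T : topologicalType) (A : set T) (x : T) :
  A x -> nbhs (x : subspace A) = within A (nbhs x).
Proof. by move=> Ax; rewrite (nbhs_subspace_in Ax). Qed.

Lemma subspace_outE (T : topologicalType) (A : set T) (x : T) :
  ~ A x -> nbhs (x : subspace A) = globally [set x].
Proof. by move=> Ax; rewrite (nbhs_subspace_out Ax). Qed.

(** [subspace (A]*[B)] retains all points of T x U, those outside A x B being isolated. They are
    separated by singletons and by A x B itself; for two points of A x B the projections reduce the
    claim to the factors. *)
Lemma hausdorff_subspaceX (T U : topologicalType) (A : set T) (B : set U) :
  hausdorff_space (subspace A) -> hausdorff_space (subspace B) ->
  hausdorff_space (subspace (A `*` B)).
Proof.
move=> hA hB p q pq.
case: (pselect ((A `*` B) p)) => [ABp|nABp]; last first.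
  have pN : nbhs (p : subspace (A `*` B)) [set p].
    by rewrite subspace_outE// => x.
  case: (pselect ((A `*` B) q)) => [ABq|nABq].
    have qN : nbhs (q : subspace (A `*` B)) (A `*` B).
      by rewrite subspace_inE//; exact: withinT.
    by have [_ [-> /nABp]] := pq _ _ pN qN.
  have qN : nbhs (q : subspace (A `*` B)) [set q].
    by rewrite subspace_outE// => x.
  by have [_ [-> /=]] := pq _ _ pN qN.
case: (pselect ((A `*` B) q)) => [ABq|nABq]; last first.
  have pN : nbhs (p : subspace (A `*` B)) (A `*` B).
    by rewrite subspace_inE//; exact: withinT.
  have qN : nbhs (q : subspace (A `*` B)) [set q].
    by rewrite subspace_outE// => x.
  by have [_ [/[swap] ->]] := pq _ _ pN qN.
have fst_nbhs (x : T * U) P : (A `*` B) x -> nbhs (x.1 : subspace A) P ->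
    nbhs (x : subspace (A `*` B)) (fst @^-1` P).
  case: x => a b [/= Aa Bb]; rewrite !subspace_inE//.
  exact: cvg_within_fst.
have snd_nbhs (x : T * U) P : (A `*` B) x -> nbhs (x.2 : subspace B) P ->
    nbhs (x : subspace (A `*` B)) (snd @^-1` P).
  case: x => a b [/= Aa Bb]; rewrite !subspace_inE//.
  exact: cvg_within_snd.
rewrite (surjective_pairing p) (surjective_pairing q); congr pair.
  apply: hA => P Q pP qQ.
  have [x [Px Qx]] := pq _ _ (fst_nbhs p P ABp pP) (fst_nbhs q Q ABq qQ).
  by exists x.1.
apply: hB => P Q pP qQ.
have [x [Px Qx]] := pq _ _ (snd_nbhs p P ABp pP) (snd_nbhs q Q ABq qQ).
by exists x.2.
Qed.

Lemma open_setX (T U : topologicalType) (A : set T) (B : set U) :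
  open A -> open B -> open (A `*` B).
Proof.
move=> oA oB; apply: openI.
  by apply: (@open_comp _ _ (@fst T U)) oA => x _; exact: cvg_fst.
by apply: (@open_comp _ _ (@snd T U)) oB => x _; exact: cvg_snd.
Qed.

Lemma nash_manifold_prod (M N : premanifold R) :
  nash_manifold M -> nash_manifold N -> nash_manifold (prod_premanifold M N).
Proof.
move=> [hM fM pM cM tM] [hN fN pN cN tN]; split.
- exact: hausdorff_subspaceX.
- exact: finite_image2.
- rewrite /= pM pN; apply/seteqP; split=> [z [[c Mc cz] [c' Nc' cz']]|z].
    by exists (prod_chart c c') => //; exists c => //; exists c'.
  by move=> [_ [c Mc [c' Nc' <-]] [cz cz']]; split; [exists c|exists c'].
- move=> _ [c Mc [c' Nc' <-]].
  have [[W oW cW] oc sc hc] := cM c Mc; have [[W' oW' cW'] oc' sc' hc'] := cN c' Nc'.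
  have img : cmap (prod_chart c c') @` cdom (prod_chart c c') =
      box (cmap c @` cdom c) (cmap c' @` cdom c') by exact: image_row_mx.
  split.
  + by exists (W `*` W'); [exact: open_setX|rewrite /= cW cW' setXI].
  + by rewrite img; exact: open_box.
  + by rewrite img; exact: semialgebraic_box.
  + by rewrite img; exact: homeo_on_row_mx.
- move=> _ _ [c Mc [c' Nc' <-]] [e Me [e' Ne' <-]].
  by apply: nash_in_charts_prod (tM _ _ Mc Me) (tN _ _ Nc' Ne').
Qed.

Definition row_chart p p' d d' (c : chart R 'rV[R]_p d) (c' : chart R 'rV[R]_p' d') :
    chart R 'rV[R]_(p + p') (d + d') :=
  Chart (box (cdom c) (cdom c')) (box_map (cmap c) (cmap c')).

Definition row_atlas p p' d d' (C : set (chart R 'rV[R]_p d))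
    (C' : set (chart R 'rV[R]_p' d')) : set (chart R 'rV[R]_(p + p') (d + d')) :=
  [set row_chart c c' | c in C & c' in C'].

(* [s] reorders the coordinates of R^n x R^n' so that those of R^d x R^d' come
   first. *)
Lemma straightening n n' d d' (led : (d <= n)%N) (led' : (d' <= n')%N)
    (ledd : (d + d' <= n + n')%N) :
  exists s t : 'I_(n + n') -> 'I_(n + n'), [/\ cancel s t, cancel t s,
    forall i : 'I_d, s (widen_ord ledd (lshift d' i)) = lshift n' (widen_ord led i),
    forall i : 'I_d', s (widen_ord ledd (rshift d i)) = rshift n (widen_ord led' i) &
    (forall i : 'I_n, (d + d' <= t (lshift n' i))%N = (d <= i)%N) /\
    (forall i : 'I_n', (d + d' <= t (rshift n i))%N = (d' <= i)%N)].
Proof.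
(* The blocks of lengths d, d', n - d, n' - d', in this order, are sent to their places in the order
   d, n - d, d', n' - d'; [tP] describes the inverse. *)
have sP (i : 'I_(n + n')) : ((if i < d then (i : nat) else
    if i < d + d' then n + (i - d) else if i < n + d' then i - d' else i) <
    n + n')%N.
  by have := ltn_ord i; repeat case: ifP; lia.
have tP (i : 'I_(n + n')) : ((if i < d then (i : nat) else
    if i < n then i + d' else if i < n + d' then i - n + d else i) < n + n')%N.
  by have := ltn_ord i; repeat case: ifP; lia.
exists (fun i => Ordinal (sP i)), (fun i => Ordinal (tP i)).
split; last split=> i /=.
- by move=> i; apply: val_inj => /=; have := ltn_ord i; repeat case: ifP; lia.
- by move=> i; apply: val_inj => /=; have := ltn_ord i; repeat case: ifP; lia.
- by move=> i; apply: val_inj; rewrite /= ltn_ord.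
- by move=> i; apply: val_inj => /=; have := ltn_ord i; repeat case: ifP; lia.
- by have := ltn_ord i; repeat case: ifP; lia.
- by have := ltn_ord i; repeat case: ifP; lia.
Qed.

(** The product of the straightenings maps onto a piece of R^d x {0} x R^d' x {0}; the permutation s
    moves both zero blocks to the end, which is the form that a chart of dimension d + d'
    requires. *)
Lemma submanifold_chart_box p p' d d' (V : set 'rV[R]_p) (V' : set 'rV[R]_p')
    (c : chart R 'rV[R]_p d) (c' : chart R 'rV[R]_p' d') :
  submanifold_chart V c -> submanifold_chart V' c' ->
  submanifold_chart (box V V') (row_chart c c').
Proof.
move=> [led [A [B [psi [npsi psiV ->]]]]] [led' [A' [B' [psi' [npsi' psiV' ->]]]]].
have ledd := leq_add led led'.
have [s [t [sK tK sl sr [tl tr]]]] := straightening led led' ledd.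
have boxIV : box V V' `&` box A A' = box (V `&` A) (V' `&` A').
  by apply/seteqP; split=> z [[? ?] [? ?]].
exists ledd, (box A A'), [set y | box B B' (colsub t y)].
exists (fun x => colsub s (box_map psi psi' x)); split.
- by apply: nash_diffeo_perm => //; exact: nash_diffeo_box.
- rewrite boxIV -[X in X @` _]/(colsub s \o box_map psi psi') -image_comp.
  rewrite image_box_map psiV psiV'.
  apply/seteqP; split=> [_ [x [[Bx x0] [B'x x0']] <-]|y [[By B'y] y0]] /=.
    rewrite colsubK//; split=> // i; rewrite -(sK i) mxE tK.
    rewrite -(fintype.splitK (s i)); case: (fintype.split (s i)) => j /=.
      by rewrite tl => /x0; rewrite mxE.
    by rewrite tr => /x0'; rewrite mxE.
  exists (colsub t y); last exact: colsubK.
  split; split=> // i di; rewrite !mxE; apply: y0; first by rewrite tl.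
  by rewrite tr.
- rewrite /row_chart boxIV; congr Chart; apply/funext => x /=.
  have colsub2E (y : 'rV[R]_(p + p')) i :
    colsub (widen_ord ledd) (colsub s y) 0 i = y 0 (s (widen_ord ledd i)).
    by rewrite !mxE.
  apply/rowP => i; rewrite colsub2E -(fintype.splitK i).
  case: (fintype.split i) => j /=.
    by rewrite sl !row_mxEl mxE.
  by rewrite sr !row_mxEr mxE.
Qed.

Lemma nash_submanifold_box p p' d d' (V : set 'rV[R]_p) (V' : set 'rV[R]_p') :
  nash_submanifold d V -> nash_submanifold d' V' ->
  nash_submanifold (d + d') (box V V').
Proof.
move=> [sV cV] [sV' cV']; split; first exact: semialgebraic_box.
move=> x [/cV[c Vc cx] /cV'[c' Vc' cx']]; exists (row_chart c c') => //.
exact: submanifold_chart_box.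
Qed.

Lemma submanifold_atlas_box p p' d d' (V : set 'rV[R]_p) (V' : set 'rV[R]_p')
    (C : set (chart R 'rV[R]_p d)) (C' : set (chart R 'rV[R]_p' d')) :
  submanifold_atlas V C -> submanifold_atlas V' C' ->
  submanifold_atlas (box V V') (row_atlas C C').
Proof.
move=> [fC CV VC] [fC' CV' VC']; split; first exact: finite_image2.
  move=> _ [c Cc [c' Cc' <-]].
  by apply: submanifold_chart_box; [exact: CV|exact: CV'].
move=> x [/VC[c Cc cx] /VC'[c' Cc' cx']].
by exists (row_chart c c') => //; exists c => //; exists c'.
Qed.

Lemma nash_in_charts_row T T' p p' q q' d d' (c : chart R T p) (c' : chart R T' p')
    (e : chart R 'rV[R]_q d) (e' : chart R 'rV[R]_q' d') f f' :
  nash_in_charts c e f -> nash_in_charts c' e' f' ->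
  nash_in_charts (prod_chart c c') (row_chart e e')
    (fun z => row_mx (f z.1) (f' z.2)).
Proof.
apply: nash_in_charts_prod => [|z] /=; last by rewrite box_map_row_mx.
by apply/seteqP; split=> z; rewrite /= box_row_mx.
Qed.

Lemma compact_affine_nash_manifold_prod (M N : premanifold R) :
  compact_affine_nash_manifold M -> compact_affine_nash_manifold N ->
  compact_affine_nash_manifold (prod_premanifold M N).
Proof.
move=> [nM cM [n [d [V [C [f [nV aV [hf ff]]]]]]]].
move=> [nN cN [n' [d' [V' [C' [f' [nV' aV' [hf' ff']]]]]]]]; split.
- exact: nash_manifold_prod.
- exact: compact_setX.
- exists (n + n')%N, (d + d')%N, (box V V'), (row_atlas C C').
  exists (fun z => row_mx (f z.1) (f' z.2)); split.
  + exact: nash_submanifold_box.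
  + exact: submanifold_atlas_box.
  + split; first exact: homeo_on_row_mx.
    move=> _ _ [c Mc [c' Nc' <-]] [e Ce [e' Ce' <-]].
    by apply: nash_in_charts_row; [exact: ff|exact: ff'].
Qed.

(** In a chart, V is the projection to R^d of a piece of R^d x {0}. That projection equals the set
    of z with (z, 0) in the straightened open set, a preimage under a polynomial map. *)
Lemma semialgebraic_in_submanifold p d (V : set 'rV[R]_p)
    (C : set (chart R 'rV[R]_p d)) :
  submanifold_atlas V C -> @semialgebraic_in R (submanifold V C) V.
Proof.
move=> [_ CV _]; split=> // c /CV[led [A [B [psi [[_ _ [_ [_ sB _ _] _]] psiV ->]]]]] /=.
rewrite setIA setIid -[X in X @` _]/(colsub (widen_ord led) \o psi) -image_comp psiV.
(* [insub] succeeds exactly for i < d; the default 0 fills the remaining coordinates. *)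
pose pad (z : 'rV[R]_d) : 'rV[R]_p := \row_i oapp (z 0) 0 (insub (i : nat)).
have padE z (i : 'I_d) : pad z 0 (widen_ord led i) = z 0 i.
  by rewrite mxE /= valK.
have pad0 z (i : 'I_p) : (d <= i)%N -> pad z 0 i = 0.
  by move=> di; rewrite mxE insubF// ltnNge di.
rewrite (_ : _ @` _ = pad @^-1` B); last first.
  apply/seteqP; split=> [_ [y [By y0] <-]|z Bz] /=.
    rewrite (_ : pad _ = y)//; apply/rowP => i.
    have [di|id] := leqP d i; first by rewrite pad0// y0.
    have -> : i = widen_ord led (Ordinal id) by exact: val_inj.
    by rewrite padE mxE.
  exists (pad z); first by split=> // i; exact: pad0.
  by apply/rowP => i; rewrite mxE padE.
apply: semialgebraic_preimage sB.
exists (fun i => oapp (fun j => mpoly.mpolyX R (mpoly.mnm1 j)) (mpoly.mpolyC d 0)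
  (insub (i : nat) : option 'I_d)) => z _ i.
rewrite mxE; case: insub => [j|] /=; rewrite /peval ?mpoly.mevalXU//.
by rewrite mpoly.mevalC.
Qed.

End ProductCharts.

(** * Semialgebraic, arc-symmetric and AS-sets in products *)

Section ArcSymmetricProducts.
Variable R : realType.

(* [c] reads as the pair of charts [(c1, c2)], up to the order of coordinates:
   [j1] and [j2] locate the coordinates of [c1] and [c2] among those of [c]. *)
Definition is_product_chart (T T1 T2 : Type) d d1 d2 (p1 : T -> T1) (p2 : T -> T2)
    (c : chart R T d) (c1 : chart R T1 d1) (c2 : chart R T2 d2) :=
  cdom c = p1 @^-1` cdom c1 `&` p2 @^-1` cdom c2 /\
  exists (j1 : 'I_d1 -> 'I_d) (j2 : 'I_d2 -> 'I_d),
    [/\ forall x, cmap c1 (p1 x) = colsub j1 (cmap c x),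
        forall x, cmap c2 (p2 x) = colsub j2 (cmap c x) &
        forall i, (exists k, j1 k = i) \/ (exists k, j2 k = i)].

(** Charts are matched in both directions: a chart of M must split for semialgebraicity to be tested
    on the factors, and charts of M1 and M2 must assemble into one of M for an arc to be
    projected. *)
Definition is_product (M M1 M2 : premanifold R) (p1 : carrier M -> carrier M1)
    (p2 : carrier M -> carrier M2) :=
  [/\ continuous p1 /\ continuous p2,
      points M = p1 @^-1` points M1 `&` p2 @^-1` points M2,
      forall x1 x2, exists x, p1 x = x1 /\ p2 x = x2,
      forall c, atlas M c -> exists c1 c2,
        [/\ atlas M1 c1, atlas M2 c2 & is_product_chart p1 p2 c c1 c2] &
      forall c1 c2, atlas M1 c1 -> atlas M2 c2 -> exists2 c,
        atlas M c & is_product_chart p1 p2 c c1 c2].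

Definition charts_cover (M : premanifold R) :=
  points M `<=` \bigcup_(c in atlas M) cdom c.

Lemma is_product_sym M M1 M2 p1 p2 :
  @is_product M M1 M2 p1 p2 -> @is_product M M2 M1 p2 p1.
Proof.
have chart_sym T T1 T2 d d1 d2 q1 q2 c c1 c2 :
    @is_product_chart T T1 T2 d d1 d2 q1 q2 c c1 c2 ->
    is_product_chart q2 q1 c c2 c1.
  move=> [cE [j1 [j2 [c1E c2E j12]]]]; split; first by rewrite cE setIC.
  by exists j2, j1; split=> // i; case: (j12 i); [right|left].
move=> [[p1c p2c] pE pair cE c12]; split=> //.
- by rewrite pE setIC.
- by move=> x2 x1; have [x [? ?]] := pair x1 x2; exists x.
- move=> c /cE[c1 [c2 [? ? /chart_sym ?]]]; by exists c2, c1.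
- move=> c2 c1 Mc2 Mc1; have [c Mc /chart_sym ?] := c12 _ _ Mc1 Mc2.
  by exists c.
Qed.

(** Analyticity of the arc is known only in charts of M. To reach a chart c1 of M1, a chart of M2
    around the other component is joined to it, whence the covering condition on M2; the coordinates
    of c1 are then among those of the joint chart. *)
Lemma analytic_arc_proj M M1 M2 p1 p2 gamma : charts_cover M2 ->
  @is_product M M1 M2 p1 p2 -> analytic_arc gamma ->
  @analytic_arc R M1 (p1 \o gamma).
Proof.
move=> M2c [[p1c _] pE _ _ c12] [gM gc ga]; split.
- by move=> _ [t t1 <-]; have : points M (gamma t) by [apply: gM; exists t];
    rewrite pE => -[].
- move/subspace_continuousP : gc => gc; apply/subspace_continuousP => t t1.
  exact: cvg_comp (gc t t1) (p1c _).
- move=> t t1 c1 Mc1 c1t.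
  have : points M (gamma t) by apply: gM; exists t.
  rewrite pE => -[_ /M2c[c2 Mc2 c2t]].
  have [c Mc [cE [j1 [j2 [c1E _ _]]]]] := c12 _ _ Mc1 Mc2.
  have : cdom c (gamma t) by rewrite cE.
  move=> /(ga t t1 c Mc); apply: analytic_at_coords => j; exists (j1 j) => s.
  by rewrite c1E mxE.
Qed.

Section Projections.
Variables (M M1 M2 : premanifold R).
Variables (p1 : carrier M -> carrier M1) (p2 : carrier M -> carrier M2).
Hypothesis Mprod : is_product p1 p2.
Hypotheses (M1c : charts_cover M1) (M2c : charts_cover M2).

Let arc1 gamma (ga : analytic_arc gamma) := analytic_arc_proj M2c Mprod ga.
Let arc2 gamma (ga : analytic_arc gamma) :=
  analytic_arc_proj M1c (is_product_sym Mprod) ga.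

Lemma semialgebraic_in_prod A1 A2 : semialgebraic_in A1 -> semialgebraic_in A2 ->
  semialgebraic_in (p1 @^-1` A1 `&` p2 @^-1` A2).
Proof.
have [_ pE pair cE _] := Mprod => -[A1M sA1] [A2M sA2]; split.
  by rewrite pE => x [/A1M ? /A2M].
move=> c /cE[c1 [c2 [Mc1 Mc2 [domE [j1 [j2 [c1E c2E j12]]]]]]].
rewrite (_ : _ @` _ = [set y | (cmap c1 @` (A1 `&` cdom c1)) (colsub j1 y)] `&`
                      [set y | (cmap c2 @` (A2 `&` cdom c2)) (colsub j2 y)]).
  by apply: semialgebraicI; apply: semialgebraic_colsub; [exact: sA1|exact: sA2].
apply/seteqP; split=> [_ [x [[A1x A2x] +] <-]|y].
  rewrite domE => -[c1x c2x].
  by split; [exists (p1 x)|exists (p2 x)]; rewrite ?c1E ?c2E.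
move=> [[x1 [A1x c1x] x1E] [x2 [A2x c2x] x2E]].
have [x [x1p x2p]] := pair x1 x2; exists x.
  by rewrite domE /= x1p x2p.
(* Each coordinate of c comes from c1 or c2, so agreement of both components forces equality in
   c. *)
apply/rowP => i; have [[k <-]|[k <-]] := j12 i.
  have : colsub j1 (cmap c x) = colsub j1 y by rewrite -c1E x1p.
  by move/rowP/(_ k); rewrite !mxE.
have : colsub j2 (cmap c x) = colsub j2 y by rewrite -c2E x2p.
by move/rowP/(_ k); rewrite !mxE.
Qed.

Lemma arc_symmetric_prod A1 A2 : arc_symmetric A1 -> arc_symmetric A2 ->
  arc_symmetric (p1 @^-1` A1 `&` p2 @^-1` A2).
Proof.
move=> sA1 sA2 gamma ga gA _ [t t1 <-]; split.
  apply: (sA1 _ (arc1 ga)); last by exists t.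
  by move=> _ [s s0 <-]; have [|] := gA (gamma s); first by exists s.
apply: (sA2 _ (arc2 ga)); last by exists t.
by move=> _ [s s0 <-]; have [|] := gA (gamma s); first by exists s.
Qed.

Lemma AS_set_prod A1 A2 : AS_set A1 -> AS_set A2 ->
  AS_set (p1 @^-1` A1 `&` p2 @^-1` A2).
Proof.
move=> [sA1 aA1] [sA2 aA2]; split; first exact: semialgebraic_in_prod.
move=> gamma ga gA.
have [|e1 e1I g1] := aA1 _ (arc1 ga).
  by move=> _ [s s0 <-]; have [|] := gA (gamma s); first by exists s.
have [|e2 e2I g2] := aA2 _ (arc2 ga).
  by move=> _ [s s0 <-]; have [|] := gA (gamma s); first by exists s.
exists (Num.min e1 e2).
  by rewrite /Num.min; case: ifP.
move=> _ [t /= + <-]; rewrite in_itv /= lt_min => /and3P[t0 t1 t2]; split.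
  by apply: g1; exists t; rewrite //= in_itv /= t0.
by apply: g2; exists t; rewrite //= in_itv /= t0.
Qed.

End Projections.

Lemma is_product_prod (M N : premanifold R) :
  @is_product (prod_premanifold M N) M N fst snd.
Proof.
have prodE c c' : is_product_chart fst snd (@prod_chart R (carrier M) (carrier N)
    (dimension M) (dimension N) c c') c c'.
  split=> //; exists (lshift (dimension N)), (@rshift (dimension M) (dimension N)).
  split=> [x|x|i].
  - by rewrite -lsubmxEsub row_mxKl.
  - by rewrite -rsubmxEsub row_mxKr.
  - by rewrite -(fintype.splitK i); case: (fintype.split i) => k; [left|right]; exists k.
split=> //.
- by split=> x; [exact: cvg_fst|exact: cvg_snd].
- by move=> x y; exists (x, y).
- by move=> _ [c Mc [c' Nc' <-]]; exists c, c'.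
- by move=> c c' Mc Nc'; exists (prod_chart c c') => //; exists c => //; exists c'.
Qed.

Lemma is_product_submanifold p p' d d' (V : set 'rV[R]_p) (V' : set 'rV[R]_p')
    (C : set (chart R 'rV[R]_p d)) (C' : set (chart R 'rV[R]_p' d')) :
  @is_product (submanifold (box V V') (row_atlas C C')) (submanifold V C)
    (submanifold V' C') (@lsubmx R 1 p p') (@rsubmx R 1 p p').
Proof.
have rowE c c' : is_product_chart (@lsubmx R 1 p p') (@rsubmx R 1 p p')
    (@row_chart R p p' d d' c c') c c'.
  split=> //; exists (lshift d'), (@rshift d d').
  split=> [x|x|i].
  - by rewrite -lsubmxEsub row_mxKl.
  - by rewrite -rsubmxEsub row_mxKr.
  - by rewrite -(fintype.splitK i); case: (fintype.split i) => k; [left|right]; exists k.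
split=> //.
- by split; [exact: continuous_lsubmx|exact: continuous_rsubmx].
- by move=> x y; exists (row_mx x y); rewrite row_mxKl row_mxKr.
- by move=> _ [c Mc [c' Nc' <-]]; exists c, c'.
- by move=> c c' Mc Nc'; exists (row_chart c c') => //; exists c => //; exists c'.
Qed.

Lemma continuous_pair (T U V : topologicalType) (f : T -> U) (g : T -> V) :
  continuous f -> continuous g -> continuous (fun x => (f x, g x)).
Proof. by move=> fc gc x; exact: cvg_pair (fc x) (gc x). Qed.

(* The factors of M x N x (V x V') are regrouped as (M x V) x (N x V'). *)
Lemma is_product_interchange (M N : premanifold R) p p' d d'
    (V : set 'rV[R]_p) (V' : set 'rV[R]_p')
    (C : set (chart R 'rV[R]_p d)) (C' : set (chart R 'rV[R]_p' d')) :
  @is_product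
    (prod_premanifold (prod_premanifold M N)
       (submanifold (box V V') (row_atlas C C')))
    (prod_premanifold M (submanifold V C))
    (prod_premanifold N (submanifold V' C'))
    (fun z => (z.1.1, lsubmx z.2)) (fun z => (z.1.2, rsubmx z.2)).
Proof.
have chartE (c : chart R (carrier M) (dimension M))
    (c' : chart R (carrier N) (dimension N)) e e' :
    is_product_chart (fun z : carrier M * carrier N * 'rV_(p + p') =>
      (z.1.1, lsubmx z.2)) (fun z => (z.1.2, rsubmx z.2))
      (prod_chart (prod_chart c c') (@row_chart R p p' d d' e e'))
      (prod_chart c e) (prod_chart c' e').
  split; first by apply/seteqP; split=> z /= [[? ?] [? ?]].
  set sigma := @interchange (dimension M) (dimension N) d d'.
  exists (sigma \o lshift _), (sigma \o @rshift _ _).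
  have rowE z : colsub sigma
      (cmap (prod_chart (prod_chart c c') (row_chart e e')) z) =
      row_mx (cmap (prod_chart c e) (z.1.1, lsubmx z.2))
             (cmap (prod_chart c' e') (z.1.2, rsubmx z.2)).
    exact: colsub_interchange.
  split=> [z|z|i].
  - rewrite (_ : colsub _ _ = lsubmx (colsub sigma
      (cmap (prod_chart (prod_chart c c') (row_chart e e')) z))).
      by rewrite rowE row_mxKl.
    by apply/rowP => k; rewrite [RHS]mxE [RHS]mxE [LHS]mxE.
  - rewrite (_ : colsub _ _ = rsubmx (colsub sigma
      (cmap (prod_chart (prod_chart c c') (row_chart e e')) z))).
      by rewrite rowE row_mxKr.
    by apply/rowP => k; rewrite [RHS]mxE [RHS]mxE [LHS]mxE.
  - rewrite -(interchangeK i) -(fintype.splitK (interchange i)).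
    by case: (fintype.split _) => k; [left|right]; exists k.
split=> //.
- split; apply: continuous_pair => z.
  + by apply: continuous_comp; exact: cvg_fst.
  + by apply: continuous_comp; [exact: cvg_snd|exact: continuous_lsubmx].
  + by apply: continuous_comp; [exact: cvg_fst|exact: cvg_snd].
  + by apply: continuous_comp; [exact: cvg_snd|exact: continuous_rsubmx].
- by apply/seteqP; split=> z /= [[? ?] [? ?]].
- by move=> [x a] [y b]; exists ((x, y), row_mx a b); rewrite row_mxKl row_mxKr.
- move=> _ [_ [c Mc [c' Nc' <-]] [_ [e Ce [e' Ce' <-]] <-]].
  exists (prod_chart c e), (prod_chart c' e'); split=> //.
    by exists c => //; exists e.
  by exists c' => //; exists e'.
- move=> _ _ [c Mc [e Ce <-]] [c' Nc' [e' Ce' <-]].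
  exists (prod_chart (prod_chart c c') (row_chart e e')) => //.
  exists (prod_chart c c'); first by exists c => //; exists c'.
  by exists (row_chart e e') => //; exists e => //; exists e'.
Qed.

End ArcSymmetricProducts.

(** * The linearization of the product and its freeness *)

Section DiagonalLinearization.
Variables (R : realType) (G : algebraic_group R).

Lemma charts_cover_prod (M N : premanifold R) : charts_cover M ->
  charts_cover N -> charts_cover (prod_premanifold M N).
Proof.
move=> Mc Nc z [/Mc[c Mcc cz] /Nc[c' Ncc' cz']].
by exists (prod_chart c c') => //; exists c => //; exists c'.
Qed.

Lemma charts_cover_submanifold p d (V : set 'rV[R]_p)
    (C : set (chart R 'rV[R]_p d)) :
  submanifold_atlas V C -> charts_cover (submanifold V C).
Proof. by case. Qed.

Lemma charts_cover_nash_manifold (M : premanifold R) :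
  nash_manifold M -> charts_cover M.
Proof. by move=> [_ _ Mc _ _]; rewrite /charts_cover -Mc. Qed.

Lemma AS_set_submanifold_box p p' d d' (V : set 'rV[R]_p) (V' : set 'rV[R]_p')
    (C : set (chart R 'rV[R]_p d)) (C' : set (chart R 'rV[R]_p' d')) A A' :
  submanifold_atlas V C -> submanifold_atlas V' C' ->
  @AS_set R (submanifold V C) A -> @AS_set R (submanifold V' C') A' ->
  @AS_set R (submanifold (box V V') (row_atlas C C')) (box A A').
Proof.
move=> /charts_cover_submanifold Cc /charts_cover_submanifold C'c sA sA'.
rewrite boxE; exact: (AS_set_prod (@is_product_submanifold _ _ _ _ _ _ _ _ _)).
Qed.

Lemma AS_closure_box_r p p' d d' (V : set 'rV[R]_p) (V' : set 'rV[R]_p')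
    (C : set (chart R 'rV[R]_p d)) (C' : set (chart R 'rV[R]_p' d')) A A' x :
  submanifold_atlas V C -> submanifold_atlas V' C' -> A `<=` V ->
  @AS_closure R (submanifold (box V V') (row_atlas C C')) (box A A') x ->
  @AS_closure R (submanifold V' C') A' (rsubmx x).
Proof.
move=> aC aC' AV xA F [sF aF AF].
have Cc := charts_cover_submanifold aC; have C'c := charts_cover_submanifold aC'.
have prodP := @is_product_submanifold R p p' d d' V V' C C'.
suff : (@lsubmx R 1 p p' @^-1` V `&` @rsubmx R 1 p p' @^-1` F) x by case.
apply: xA; split.
- exact: (semialgebraic_in_prod prodP (semialgebraic_in_submanifold aC)).
- apply: (arc_symmetric_prod prodP) => //.
  (* V is arc-symmetric in itself, since analytic arcs take their values in the manifold by
     definition. *)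
  by move=> gamma [gM _ _] _.
- by move=> y [/AV ? /AF].
Qed.

Lemma polynomial_representation_block n n' (rho : gelt G -> 'M[R]_n)
    (rho' : gelt G -> 'M[R]_n') :
  polynomial_representation rho -> polynomial_representation rho' ->
  polynomial_representation (fun g => block_mx (rho g) 0 0 (rho' g)).
Proof.
move=> [rho1 rhoM [P rhoP]] [rho1' rhoM' [P' rhoP']]; split.
- by rewrite rho1 rho1' -scalar_mx_block.
- move=> g h Gg Gh; rewrite mulmx_block !(mulmx0, mul0mx, addr0, add0r).
  by rewrite rhoM// rhoM'.
- exists (fun i j => match fintype.split i, fintype.split j with
    | inl k, inl l => P k l | inr k, inr l => P' k l
    | _, _ => mpoly.mpolyC _ 0 end) => g Gg i j.
  rewrite -(fintype.splitK i) -(fintype.splitK j).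
  case: (fintype.split i) => k; case: (fintype.split j) => l;
    rewrite !unsplitK /= ?(block_mxEul, block_mxEur, block_mxEdl, block_mxEdr).
  + exact: rhoP.
  + by rewrite mxE /peval mpoly.mevalC.
  + by rewrite mxE /peval mpoly.mevalC.
  + exact: rhoP'.
Qed.

Lemma rep_act_block n n' (rho : gelt G -> 'M[R]_n) (rho' : gelt G -> 'M[R]_n') g
    x y :
  rep_act (fun g => block_mx (rho g) 0 0 (rho' g)) g (row_mx x y) =
  row_mx (rep_act rho g x) (rep_act rho' g y).
Proof.
by rewrite /rep_act tr_block_mx mul_row_block !trmx0 !mulmx0 addr0 add0r.
Qed.

Section Linearization.
Variables (M N : premanifold R) (A : set (carrier M)) (S : set (carrier N)).
Variables (actA : gelt G -> carrier M -> carrier M).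
Variables (actS : gelt G -> carrier N -> carrier N).
Hypotheses (Mc : charts_cover M) (Nc : charts_cover N).
Variables (L : linearization A actA) (L' : linearization S actS).

(** Built by tactics but closed with [Defined]: the proof of freeness unfolds its representation,
    manifold and image. *)
Definition diagonal_linearization :
  @linearization R G (prod_premanifold M N) (A `*` S) (diagonal_action actA actS).
Proof.
apply: (@Linearization R G (prod_premanifold M N) (A `*` S)
  (diagonal_action actA actS) _ (fun g => block_mx (lin_rho L g) 0 0 (lin_rho L' g))
  _ (box (lin_N L) (lin_N L')) (row_atlas (lin_atlas L) (lin_atlas L'))
  (box (lin_S L) (lin_S L')) (fun z => row_mx (lin_map L z.1) (lin_map L' z.2))).
- by apply: polynomial_representation_block; exact: lin_rho_polynomial.
- by apply: nash_submanifold_box; exact: lin_N_nash.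
- by apply: compact_box; exact: lin_N_compact.
- by apply: submanifold_atlas_box; exact: lin_atlasP.
- apply: AS_set_submanifold_box.
  + exact: lin_atlasP.
  + exact: lin_atlasP.
  + exact: lin_S_AS.
  + exact: lin_S_AS.
- move=> g x Gg [Sx S'x]; rewrite -(hsubmxK x) rep_act_block box_row_mx.
  by split; exact: lin_S_stable.
- by apply: homeo_on_row_mx; exact: lin_homeo.
- move=> g [x y] Gg [/= Ax Sy]; rewrite rep_act_block.
  by congr row_mx; exact: lin_equivariant.
(* A point ((x, y), (v, w)) is on the graph exactly when (x, v) and (y, w) are on the given graphs,
   which calls for the regrouped product structure. *)
- rewrite (_ : [set _ | _ in _] =
      (fun z => (z.1.1, lsubmx z.2)) @^-1` [set (x, lin_map L x) | x in A] `&`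
      (fun z => (z.1.2, rsubmx z.2)) @^-1` [set (y, lin_map L' y) | y in S]).
    apply: (AS_set_prod (@is_product_interchange _ M N _ _ _ _ _ _ _ _)).
    + by apply: charts_cover_prod => //;
        apply: charts_cover_submanifold; exact: lin_atlasP.
    + by apply: charts_cover_prod => //;
        apply: charts_cover_submanifold; exact: lin_atlasP.
    + exact: lin_graph.
    + exact: lin_graph.
  apply/seteqP; split=> [_ [[x y] [/= Ax Sy] <-] /=|[[x y] w] /= []].
    by rewrite row_mxKl row_mxKr; split; [exists x|exists y].
  move=> [a Aa [ax fx]] [b Sb [yb fy]]; exists (a, b) => //=.
  by rewrite fx fy hsubmxK ax yb.
Defined.

Lemma free_diagonal_linearization :
  free_linearization L' -> free_linearization diagonal_linearization.
Proof.
move=> L'free g x Gg xcl; rewrite /= -{1}(hsubmxK x) rep_act_block.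
(* An element fixing x fixes its second component, and this component lies in the AS-closure of
   S'. *)
rewrite -[RHS](hsubmxK x) => /eq_row_mx[_ gx]; apply: L'free gx => //.
apply: AS_closure_box_r xcl; [exact: lin_atlasP|exact: lin_atlasP|].
by have [[]] := lin_S_AS L.
Qed.

End Linearization.

End DiagonalLinearization.

Theorem proposition8p2p6 (R : realType) (G : algebraic_group R)
    (M N : premanifold R) (A : set (carrier M)) (S : set (carrier N))
    (actA : gelt G -> carrier M -> carrier M)
    (actS : gelt G -> carrier N -> carrier N) :
  compact (gset G) ->
  free_G_AS_set S actS ->
  G_AS_set A actA ->
  @free_G_AS_set R G (prod_premanifold M N) (A `*` S)
    (diagonal_action actA actS).
Proof.
move=> _ [nN sS [aS aS1 aSM] [L' L'free]] [nM sA [aA aA1 aAM] [L]].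
have Mc : charts_cover M by case: nM => /charts_cover_nash_manifold.
have Nc : charts_cover N by case: nN => /charts_cover_nash_manifold.
split.
- exact: compact_affine_nash_manifold_prod.
- exact: (AS_set_prod (is_product_prod M N)).
- split=> [g z Gg [Az Sz]|[x y] [/= Ax Sy]|g h [x y] Gg Gh [/= Ax Sy]].
  + by split; [exact: aA|exact: aS].
  + by rewrite /diagonal_action /= aA1// aS1.
  + by rewrite /diagonal_action /= aAM// aSM.
- exists (diagonal_linearization Mc Nc L L').
  exact: free_diagonal_linearization.
Qed.
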